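(* Let $\{(x_i,y_i)\in\mathbb{R}^2: i=0,\ldots,N\}$ be interpolation data, let $g_\sigma$ be the Super Fractal Interpolation Function (SFIF), for $\sigma\in\Lambda$, corresponding to the SIFS $\big\{\{\mathbb{R}^2;\ \omega_{n,k}(x,y)=(L_n(x),\gamma_{n,k}y+q_{n,k}(x)): n=1,\ldots,N\},\ k=1,\ldots,M\big\}$ described in the context, and let $\hat y_0\in\mathbb{R}$ be arbitrary. Then the integral $$\hat g_\sigma(x)=\hat y_0+\int_{x_0}^x g_\sigma(t)\,dt,\qquad x\in I,$$ is the SFIF, for the same $\sigma$, associated with the SIFS $\big\{\{\mathbb{R}^2;\ \hat\omega_{n,k}(x,y)=(L_n(x),\hat\gamma_{n,k}y+\hat q_{n,k}(x)): n=1,\ldots,N\},\ k=1,\ldots,M\big\}$ for the interpolation data $\{(x_i,\hat y_i): i=0,\ldots,N\}$, where $\hat\gamma_{n,k},\hat q_{n,k},\hat y_i$ are as defined in the context.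
   Context: Let $N\ge2$, $M>1$ be integers, $x_0<x_1<\cdots<x_N$ reals, $y_0,\ldots,y_N\in\mathbb{R}$, $I=[x_0,x_N]$. For $n=1,\ldots,N$ let $L_n(x)=a_nx+b_n=\dfrac{(x_n-x_{n-1})x+(x_Nx_{n-1}-x_0x_n)}{x_N-x_0}$. General notions. A Super Iterated Function System (SIFS) associated with data $\{(x_i,z_i): i=0,\ldots,N\}$ is a pool of IFSs $\big\{\{\mathbb{R}^2;(L_n(x),F_{n,k}(x,y)): n=1,\ldots,N\},\ k=1,\ldots,M\big\}$ with $F_{n,k}(x,y)=c_{n,k}y+p_{n,k}(x)$, $|c_{n,k}|<1$, $c_{n,k}\neq c_{n,l}$ for $k\ne l$, $p_{n,k}$ continuous on $I$, satisfying the join-up conditions $F_{n,k}(x_0,z_0)=z_{n-1}$, $F_{n,k}(x_N,z_N)=z_n$. Write $\mathcal{H}$ for the nonempty compact subsets of $I\times\mathbb{R}$ with the Hausdorff metric and $W_k(A)=\bigcup_{n=1}^N\{(L_n(x),F_{n,k}(x,y)):(x,y)\in A\}$. Let $\Lambda$ be the set of sequences $\sigma=\sigma_1\sigma_2\ldots$ with $\sigma_j\in\{1,\ldots,M\}$. The attractor of the SIFS for $\sigma\in\Lambda$ is $\lim_{k\to\infty}W_{\sigma_k}\circ\cdots\circ W_{\sigma_1}(S_0)$ in the Hausdorff metric, where $S_0=\{(x_i,z_i): i=0,\ldots,N\}$. The Super Fractal Interpolation Function (SFIF) associated with (corresponding to) the SIFS for $\sigma$ is the continuous function $I\to\mathbb{R}$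 whose graph is this attractor. The original SIFS. $G_{n,k}(x,y)=\gamma_{n,k}y+q_{n,k}(x)$ with $|\gamma_{n,k}|<1$, $\gamma_{n,k}\neq\gamma_{n,l}$ for $k\neq l$, $q_{n,k}$ affine, and $G_{n,k}(x_0,y_0)=y_{n-1}$, $G_{n,k}(x_N,y_N)=y_n$. It is assumed that $$\frac{\sum_{j=1}^N a_j\int_{x_0}^{x_N}q_{j,k}(t)\,dt}{1-\sum_{j=1}^N a_j\gamma_{j,k}}=\frac{\sum_{j=1}^N a_j\int_{x_0}^{x_N}q_{j,l}(t)\,dt}{1-\sum_{j=1}^N a_j\gamma_{j,l}}\neq1\quad\text{for }k\neq l,\ k,l=1,\ldots,M.$$ The new SIFS. Given $\hat y_0$, put $\hat\gamma_{n,k}=a_n\gamma_{n,k}$, $\hat y_{0,k}=\hat y_0$, and $$\hat y_{N,k}=\hat y_0+\frac{\sum_{j=1}^N a_j\int_{x_0}^{x_N}q_{j,k}(t)\,dt}{1-\sum_{j=1}^N a_j\gamma_{j,k}},\qquad \hat y_{n,k}=\hat y_0+\sum_{j=1}^n a_j\Big[\gamma_{j,k}(\hat y_{N,k}-\hat y_0)+\int_{x_0}^{x_N}q_{j,k}(t)\,dt\Big],$$ $$\hat q_{n,k}(x)=\hat y_{n-1,k}-a_n\gamma_{n,k}\hat y_0+a_n\int_{x_0}^xq_{n,k}(t)\,dt.$$ It is assumed that $\hat y_{i,k}=\hat y_{i,l}=:\hat y_i$ for all $i=0,\ldots,N$ and $k,l=1,\ldots,M$. The functions $\hat G_{n,k}(x,y)=\hat\gamma_{n,k}y+\hat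 q_{n,k}(x)$ then satisfy the join-up conditions $\hat G_{n,k}(x_0,\hat y_0)=\hat y_{n-1}$, $\hat G_{n,k}(x_N,\hat y_N)=\hat y_n$. *)

(* Defs.v *)
From mathcomp Require Import all_boot all_order all_algebra.
From mathcomp Require Import all_classical all_reals all_analysis.

Set Implicit Arguments.
Unset Strict Implicit.
Unset Printing Implicit Defensive.

Import Order.TTheory GRing.Theory Num.Theory.
Import numFieldNormedType.Exports.

Local Open Scope classical_set_scope.
Local Open Scope ring_scope.

(* The data index i = 0, ..., N is an element of 'I_N.+1.  The map index
   n = 1, ..., N is shifted by one to n : 'I_N, so that the subinterval attached
   to n has end points x (lnode n) and x (rnode n). *)
Definition lnode (N : nat) (n : 'I_N) : 'I_N.+1 := widen_ord (leqnSn N) n.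
Definition rnode (N : nat) (n : 'I_N) : 'I_N.+1 := lift ord0 n.

Section Hausdorff.
Variable R : realType.
Implicit Types (p : R * R) (A B : set (R * R)).

Definition edist2 p p' : R :=
  Num.sqrt ((p.1 - p'.1) ^+ 2 + (p.2 - p'.2) ^+ 2).

Definition dist_to_set p B : R := inf [set edist2 p b | b in B].

(* [sup] and [inf] of real sets are only meaningful on nonempty bounded sets;
   this is the case when A and B are nonempty and compact. *)
Definition hausdorff_dist A B : R :=
  Num.max (sup [set dist_to_set a B | a in A])
          (sup [set dist_to_set b A | b in B]).

Definition nonempty_compact_in (I : set R) A : Prop :=
  [/\ A !=set0, compact A & A `<=` I `*` setT].

Definition hausdorff_cvg (I : set R) (S : nat -> set (R * R)) A : Prop :=
  [/\ forall m, nonempty_compact_in I (S m), nonempty_compact_in I A &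
      hausdorff_dist (S m) A @[m --> \oo] --> (0 : R)].

End Hausdorff.

Section SIFS.
Variables (R : realType) (N M : nat) (x : 'I_N.+1 -> R).

Definition dom : set R := `[x ord0, x ord_max].

Definition La (n : 'I_N) : R :=
  (x (rnode n) - x (lnode n)) / (x ord_max - x ord0).
Definition Lb (n : 'I_N) : R :=
  (x ord_max * x (lnode n) - x ord0 * x (rnode n)) / (x ord_max - x ord0).
Definition L (n : 'I_N) (t : R) : R := La n * t + Lb n.

Variables (c : 'I_N -> 'I_M -> R) (p : 'I_N -> 'I_M -> R -> R).

Definition F (n : 'I_N) (k : 'I_M) (t y : R) : R := c n k * y + p n k t.

Definition is_SIFS (z : 'I_N.+1 -> R) : Prop :=
  [/\ forall n k, `|c n k| < 1,
      forall n k l, k != l -> c n k != c n l,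
      forall n k, {within dom, continuous (p n k)} &
      forall n k, F n k (x ord0) (z ord0) = z (lnode n) /\
                  F n k (x ord_max) (z ord_max) = z (rnode n)].

Definition W (k : 'I_M) (A : set (R * R)) : set (R * R) :=
  \bigcup_(n : 'I_N) [set (L n u.1, F n k u.1 u.2) | u in A].

(* [sigma j] is the letter sigma_{j+1}; hence [W_iter z sigma m] is
   W_{sigma_m} o ... o W_{sigma_1} applied to the data points. *)
Fixpoint W_iter (z : 'I_N.+1 -> R) (sigma : nat -> 'I_M) (m : nat) :
    set (R * R) :=
  if m is m'.+1 then W (sigma m') (W_iter z sigma m')
  else [set (x i, z i) | i in [set: 'I_N.+1]].

Definition is_attractor (z : 'I_N.+1 -> R) (sigma : nat -> 'I_M)
    (A : set (R * R)) : Prop :=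
  hausdorff_cvg dom (W_iter z sigma) A.

(* Only the restriction of f to [dom] is relevant. *)
Definition is_SFIF (z : 'I_N.+1 -> R) (sigma : nat -> 'I_M) (f : R -> R) :
    Prop :=
  {within dom, continuous f} /\
  is_attractor z sigma [set (t, f t) | t in dom].

End SIFS.

Section IntegratedSIFS.
Variables (R : realType) (N M : nat) (x : 'I_N.+1 -> R).
Variables (gamma : 'I_N -> 'I_M -> R) (q : 'I_N -> 'I_M -> R -> R).

Definition integral_to (f : R -> R) (s : R) : R :=
  \int[lebesgue_measure]_(t in `[x ord0, s]) f t.

Definition rise (k : 'I_M) : R :=
  (\sum_(j < N) La x j * integral_to (q j k) (x ord_max)) /
  (1 - \sum_(j < N) La x j * gamma j k).

Variable hy0 : R.

Definition hat_yN (k : 'I_M) : R := hy0 + rise k.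

(* With shifted indices the paper's sum over 1 <= j <= n is over j < n; it is
   empty for n = 0 and gives [hat_yN] for n = N, see [hat_y_max]. *)
Definition hat_y (n : 'I_N.+1) (k : 'I_M) : R :=
  hy0 + \sum_(j < N | (j < n)%N)
    La x j * (gamma j k * (hat_yN k - hy0) + integral_to (q j k) (x ord_max)).

Definition hat_gamma (n : 'I_N) (k : 'I_M) : R := La x n * gamma n k.

Definition hat_q (n : 'I_N) (k : 'I_M) (s : R) : R :=
  hat_y (lnode n) k - La x n * gamma n k * hy0
  + La x n * integral_to (q n k) s.

Lemma hat_y_0 (k : 'I_M) : hat_y ord0 k = hy0.
Proof. by rewrite /hat_y big_pred0 ?addr0. Qed.

Lemma hat_y_max (k : 'I_M) :
  1 - \sum_(j < N) La x j * gamma j k != 0 -> hat_y ord_max k = hat_yN k.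
Proof.
move=> d0; rewrite /hat_y /hat_yN; congr (_ + _).
rewrite (eq_bigl predT) => [|j]; last by rewrite ltn_ord.
rewrite addrC addKr.
under eq_bigr do rewrite mulrDr mulrA.
rewrite big_split /= -mulr_suml; set s := \sum_(j < N) La x j * gamma j k.
rewrite -[X in _ + X](divfK d0) -/(rise k) -/s [rise k * _]mulrC -mulrDl.
by rewrite addrC subrK mul1r.
Qed.

End IntegratedSIFS.

(* Main.v *)
Require Import Defs.
From mathcomp Require Import all_boot all_order all_algebra.
From mathcomp Require Import all_classical all_reals all_analysis.
From mathcomp Require Import ring lra.

Set Implicit Arguments.
Unset Strict Implicit.
Unset Printing Implicit Defensive.

Import Order.TTheory GRing.Theory Num.Theory.
Import numFieldNormedType.Exports.
Local Open Scope classical_set_scope.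
Local Open Scope ring_scope.

(** The iterates apply the maps of the latest letter last, so a continuous
    function can only be their limit in a rigid situation. If the letter k occurs
    infinitely often in sigma and the iterates converge to the graph of g, then
    [W k] sends iterates close to the graph to iterates close to the graph, and
    in the limit the graph is invariant under [W k]; that is, g solves
    [g (L x n t) = gamma n k * g t + q n k t]
    ([self_referential_of_attractor]). All letters of sigma from some rank m0 on
    occur infinitely often, because there are finitely many letters
    ([eventually_of_frequent]), so g solves the equations of all of them.

    Integrating this equation from the left end of the n-th subinterval and
    substituting [L x n u] for the variable gives, for the integral G of g and
    the integral Q of [q n k] from the left end of the interval,
    [G (L x n t) = G (x (lnode n)) + La x n * (gamma n k * G t + Q t)]
    ([integral_to_L]). Taken at the right end of the interval and summed over n,
    it is a linear equation for the total integral, with solution [rise]; its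
    partial sums identify [hy0 + G] at the nodes with [hat_y]. Hence [hy0 + G]
    solves the equations of the integrated system for the same letters
    ([self_referential_integral]).

    Conversely, invariance of the graph from rank m0 on is enough for convergence:
    the iterates of rank m0 form a finite set at bounded vertical distance from
    the graph, the vertical scalings contract this distance, and the abscissas
    become dense in the interval ([attractor_of_self_referential]). The integral
    is Lipschitz, since g is bounded, so density of the abscissas is enough to
    approximate the whole graph. *)

(** * The nodes and the affine maps between subintervals *)

Section Nodes.
Context {R : realType} {N : nat} {x : 'I_N.+1 -> R}.
Hypothesis hx : forall i j : 'I_N.+1, (i < j)%N -> x i < x j.

Lemma node_le (i j : 'I_N.+1) : (i <= j)%N -> x i <= x j.
Proof.
rewrite leq_eqVlt => /orP[/eqP/val_inj -> //|/hx/ltW //].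
Qed.

Lemma lnode_lt_rnode (n : 'I_N) : x (lnode n) < x (rnode n).
Proof. by apply: hx; rewrite /= /bump /= add1n. Qed.

Lemma node_in_dom (i : 'I_N.+1) : dom x (x i).
Proof.
rewrite /dom /= in_itv /= !node_le //=; by rewrite -ltnS ltn_ord.
Qed.

Lemma ends_lt : (0 < N)%N -> x ord0 < x ord_max.
Proof. by move=> N0; apply: hx. Qed.

Hypothesis N0 : (0 < N)%N.

Lemma La_gt0 (n : 'I_N) : 0 < La x n.
Proof. by rewrite divr_gt0 // subr_gt0 ?ends_lt ?lnode_lt_rnode. Qed.

Lemma L_lnode (n : 'I_N) : L x n (x ord0) = x (lnode n).
Proof.
have := ends_lt N0; rewrite /L /La /Lb => h; field; lra.
Qed.

Lemma L_rnode (n : 'I_N) : L x n (x ord_max) = x (rnode n).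
Proof.
have := ends_lt N0; rewrite /L /La /Lb => h; field; lra.
Qed.

Lemma L_sub (n : 'I_N) s t : L x n s - L x n t = La x n * (s - t).
Proof. by rewrite /L; ring. Qed.

Lemma L_le (n : 'I_N) s t : (L x n s <= L x n t) = (s <= t).
Proof. by rewrite /L lerD2r ler_pM2l // La_gt0. Qed.

Lemma L_dom (n : 'I_N) t : dom x t -> dom x (L x n t).
Proof.
rewrite /dom /= !in_itv /= => /andP[h0 h1]; apply/andP; split.
  apply: (@le_trans _ _ (x (lnode n))); first exact: node_le.
  by rewrite -L_lnode L_le.
apply: (@le_trans _ _ (x (rnode n))); last by apply: node_le; rewrite -ltnS.
by rewrite -L_rnode L_le.
Qed.

Lemma dom_cell t : dom x t ->
  exists n : 'I_N, x (lnode n) <= t <= x (rnode n).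
Proof.
rewrite /dom /= in_itv /= => /andP[h0 h1].
suff H j (hj : (j < N.+1)%N) : t <= x (Ordinal hj) ->
    exists n : 'I_N, x (lnode n) <= t <= x (rnode n).
  apply: (H N (ltnSn N)); apply: le_trans h1 _; exact: node_le.
elim: j hj => [|j IH] hj tj.
  exists (Ordinal N0); apply/andP; split.
    by apply: le_trans h0; exact: node_le.
  by apply: le_trans tj _; exact: node_le.
have [tj'|tj'] := leP t (x (Ordinal (ltnW hj))); first exact: IH tj'.
exists (Ordinal (hj : (j < N)%N)); apply/andP; split.
  by apply: le_trans (ltW tj'); exact: node_le.
by apply: le_trans tj _; apply: node_le; rewrite /= /bump /= add1n.
Qed.

Lemma L_surj t : dom x t -> exists n s, dom x s /\ L x n s = t.
Proof.
move=> /dom_cell[n /andP[h0 h1]].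
have a0 := La_gt0 n.
have e : L x n ((t - Lb x n) / La x n) = t by rewrite /L; field; lra.
exists n, ((t - Lb x n) / La x n); split=> //.
rewrite /dom /= in_itv /= -(L_le n) -[in X in _ && X](L_le n) e.
by rewrite L_lnode L_rnode h0.
Qed.

Lemma sum_La : \sum_(n < N) La x n = 1.
Proof.
rewrite -mulr_suml.
pose X j := x (inord j).
rewrite (eq_bigr (fun n : 'I_N => X n.+1 - X n)); last first.
  move=> n _; congr (x _ - x _); apply: val_inj;
    rewrite /= ?/bump /= ?add1n inordK //.
    by rewrite ltnS.
  by rewrite ltnS ltnW.
rewrite -(big_mkord xpredT (fun n => X n.+1 - X n)) telescope_sumr // /X.
have -> : inord N = ord_max :> 'I_N.+1 by apply: val_inj; rewrite /= inordK.
have -> : inord 0 = ord0 :> 'I_N.+1 by apply: val_inj; rewrite /= inordK.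
by rewrite divff // gt_eqF // subr_gt0 ends_lt.
Qed.

Lemma La_le1 (n : 'I_N) : La x n <= 1.
Proof.
rewrite -sum_La (bigD1 n) //= lerDl sumr_ge0 // => i _; exact/ltW/La_gt0.
Qed.

(** This is where two subintervals are needed: with a single one, [L] would be
    the identity and would contract nothing. *)
Lemma La_lt1 (n : 'I_N) : (1 < N)%N -> La x n < 1.
Proof.
move=> N1; rewrite -sum_La (bigD1 n) //= ltrDl.
have [m mn] : exists m : 'I_N, m != n.
  case: (eqVneq n (Ordinal N0)) => [->|nn]; first by exists (Ordinal N1).
  by exists (Ordinal N0); rewrite eq_sym.
rewrite (bigD1 m) //= ltr_wpDr ?La_gt0 // sumr_ge0 // => i _; exact/ltW/La_gt0.
Qed.
End Nodes.

Section NodeSums.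
Context {R : realType} {N : nat}.

Lemma sum_lt_rnode (f : 'I_N -> R) (n : 'I_N) :
  \sum_(j < N | (j < rnode n)%N) f j = \sum_(j < N | (j < lnode n)%N) f j + f n.
Proof.
rewrite /= /bump /= add1n (bigD1 n) //= addrC; congr (_ + _).
by apply: eq_bigl => j; rewrite ltnS ltn_neqAle andbC.
Qed.

Lemma telescope_nodes (u : 'I_N.+1 -> R) (f : 'I_N -> R) :
  (forall n, u (rnode n) = u (lnode n) + f n) ->
  forall i, u i = u ord0 + \sum_(j < N | (j < i)%N) f j.
Proof.
move=> uf [i]; elim: i => [|i IH] hi.
  by rewrite big_pred0 // addr0; congr u; exact: val_inj.
have -> : Ordinal hi = rnode (Ordinal (hi : (i < N)%N)).
  by apply: val_inj; rewrite /= /bump /= add1n.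
rewrite uf sum_lt_rnode addrA; congr (_ + _).
rewrite (_ : lnode _ = Ordinal (ltnW hi)) ?IH //; exact: val_inj.
Qed.

End NodeSums.

Lemma finite_lt1_bound {R : realType} (T : finType) (f : T -> R) :
  (forall i, f i < 1) -> exists2 r, 0 <= r < 1 & forall i, f i <= r.
Proof.
move=> f1; exists (\big[Num.max/0]_i f i); last by move=> i; exact: le_bigmax.
by rewrite bigmax_ge_id /=; apply: bigmax_lt.
Qed.

(** * The Hausdorff distance in the plane *)

Section Hausdorff.
Context {R : realType}.
Implicit Types (p : R * R) (A B : set (R * R)).

Lemma edist2_ge0 p p' : 0 <= edist2 p p'.
Proof. exact: sqrtr_ge0. Qed.

Lemma dist1_le_edist2 p p' : `|p.1 - p'.1| <= edist2 p p'.
Proof. by rewrite -sqrtr_sqr ler_sqrt ?lerDl ?sqr_ge0 // addr_ge0 ?sqr_ge0. Qed.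

Lemma dist2_le_edist2 p p' : `|p.2 - p'.2| <= edist2 p p'.
Proof. by rewrite -sqrtr_sqr ler_sqrt ?lerDr ?sqr_ge0 // addr_ge0 ?sqr_ge0. Qed.

Lemma edist2_le_sum p p' : edist2 p p' <= `|p.1 - p'.1| + `|p.2 - p'.2|.
Proof.
rewrite -[leRHS]ger0_norm ?addr_ge0 // -sqrtr_sqr ler_sqrt ?sqr_ge0 //.
set a := p.1 - _; set b := p.2 - _.
have sqK (u : R) : u ^+ 2 = `|u| ^+ 2 by rewrite -normrX ger0_norm ?sqr_ge0.
by rewrite (sqK a) (sqK b) sqrrD [leRHS]addrAC lerDl mulrn_wge0 // ?mulr_ge0.
Qed.

Lemma dist_to_set_ge0 p B : 0 <= dist_to_set p B.
Proof.
rewrite /dist_to_set.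
have [->|/set0P B0] := eqVneq [set edist2 p b | b in B] set0.
  by rewrite inf0.
by apply: lb_le_inf => // _ [b _ <-]; exact: edist2_ge0.
Qed.

Lemma dist_to_set_le p B b : B b -> dist_to_set p B <= edist2 p b.
Proof.
move=> Bb; apply: ge_inf; last by exists b.
by exists 0 => _ [b' _ <-]; exact: edist2_ge0.
Qed.

Lemma hausdorff_distC A B : hausdorff_dist A B = hausdorff_dist B A.
Proof. exact: maxC. Qed.

Lemma hausdorff_dist_ge0 A B : 0 <= hausdorff_dist A B.
Proof.
rewrite le_max; apply/orP; left.
have [hs|/sup_out -> //] := pselect (has_sup [set dist_to_set a B | a in A]).
have [[_ [a Aa _]] ub] := hs.
apply: le_trans (dist_to_set_ge0 a B) _.
by apply: ub_le_sup => //; exists a.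
Qed.

Lemma hausdorff_dist_le A B e : A !=set0 -> B !=set0 ->
  (forall a, A a -> exists2 b, B b & edist2 a b <= e) ->
  (forall b, B b -> exists2 a, A a & edist2 b a <= e) ->
  hausdorff_dist A B <= e.
Proof.
move=> [a Aa] [b Bb] AB BA; rewrite ge_max; apply/andP; split; apply: ge_sup.
- by exists (dist_to_set a B), a.
- move=> _ [a' /AB[b' Bb' abe] <-]; exact: le_trans (dist_to_set_le _ Bb') abe.
- by exists (dist_to_set b A), b.
- move=> _ [b' /BA[a' Aa' abe] <-]; exact: le_trans (dist_to_set_le _ Aa') abe.
Qed.

(** Compactness of [A] bounds the distances to [B] whose supremum defines
    [hausdorff_dist], without which that supremum would say nothing. *)
Lemma hausdorff_dist_lt A B e a : compact A -> B !=set0 ->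
  hausdorff_dist A B < e -> A a -> exists2 b, B b & edist2 a b < e.
Proof.
move=> cA [b0 Bb0]; rewrite gt_max => /andP[lte _] Aa.
have [M [_ /(_ (M + 1))]] := compact_bounded cA.
rewrite ltrDl ltr01 => /(_ isT) MA.
have dA : dist_to_set a B < e.
  apply: le_lt_trans lte; apply: ub_le_sup; last by exists a.
  exists ((M + 1) + `|b0.1| + ((M + 1) + `|b0.2|)) => _ [a' Aa' <-].
  apply: le_trans (dist_to_set_le _ Bb0) (le_trans (edist2_le_sum _ _) _).
  have : Num.max `|a'.1| `|a'.2| <= M + 1 := MA _ Aa'.
  rewrite ge_max => /andP[h1 h2].
  by apply: lerD; apply: le_trans (ler_normB _ _) _; rewrite lerD2r.
have [||_ [b Bb <-] abe] :=
  @inf_adherent _ [set edist2 a b | b in B] (e - dist_to_set a B).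
- by rewrite subr_gt0.
- split; first by exists (edist2 a b0), b0.
  by exists 0 => _ [b' _ <-]; exact: edist2_ge0.
- by exists b => //; move: abe; rewrite -/(dist_to_set a B) addrC subrK.
Qed.
End Hausdorff.

(** * Attractors that are graphs of self-referential functions *)

Definition graph {R : realType} {N : nat} (x : 'I_N.+1 -> R) (f : R -> R) :
    set (R * R) :=
  [set (t, f t) | t in dom x].

(** The fixed points of the Read-Bajraktarevic operator of the letter k: an f
    satisfying this equation has a graph invariant under [W k]. *)
Definition self_referential {R : realType} {N M : nat} (x : 'I_N.+1 -> R)
    (c : 'I_N -> 'I_M -> R) (p : 'I_N -> 'I_M -> R -> R) (k : 'I_M)
    (f : R -> R) : Prop :=
  forall n t, dom x t -> f (L x n t) = F c p n k t (f t).

Lemma within_continuousP {R : realType} (D : set R) (f : R -> R) :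
  {within D, continuous f} <->
  forall t, D t -> forall e, 0 < e -> exists2 d, 0 < d &
    forall s, D s -> `|t - s| < d -> `|f t - f s| < e.
Proof.
split=> [/subspace_continuousP fc t Dt e e0|H].
  have /cvgr_dist_lt/(_ e e0) := fc t Dt.
  rewrite near_withinE => /nbhs_ballP[d /= d0 H]; exists d => // s Ds ts.
  exact: H ts Ds.
apply/subspace_continuousP => t Dt; apply/cvgrPdist_lt => e e0.
have [d d0 {}H] := H t Dt e e0.
rewrite near_withinE; apply/nbhs_ballP; exists d => //= s ts Ds; exact: H.
Qed.

(** Every letter outside the infinitely recurring ones dies out, and there are
    finitely many letters. *)
Lemma eventually_of_frequent (M : nat) (sigma : nat -> 'I_M)
    (P : 'I_M -> Prop) :
  (forall k, (forall m0, exists2 m, (m0 <= m)%N & sigma m = k) -> P k) ->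
  exists m0, forall m, (m0 <= m)%N -> P (sigma m).
Proof.
move=> HP.
have H k : exists m0, forall m, (m0 <= m)%N -> sigma m = k -> P k.
  have [Pk|nPk] := pselect (P k); first by exists 0%N.
  apply: contrapT => /forallNP nH; apply: nPk; apply: HP => m0.
  have /existsNP[m /not_implyP[m0m /not_implyP[smk _]]] := nH m0.
  by exists m.
have [b bP] := choice H.
exists (\max_k b k)%N => m bm; apply: (bP (sigma m) m) => //.
exact: leq_trans (leq_bigmax _) bm.
Qed.

Section Attractor.
Context {R : realType} {N M : nat} {x : 'I_N.+1 -> R}.
Context {c : 'I_N -> 'I_M -> R} {p : 'I_N -> 'I_M -> R -> R}.
Context {z : 'I_N.+1 -> R} {sigma : nat -> 'I_M}.
Hypothesis hx : forall i j : 'I_N.+1, (i < j)%N -> x i < x j.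
Hypothesis N1 : (1 < N)%N.
Let N0 : (0 < N)%N := ltnW N1.

Lemma graph_neq0 f : graph x f !=set0.
Proof. exists (x ord0, f (x ord0)), (x ord0) => //; exact: node_in_dom. Qed.

Lemma graph_compact f : {within dom x, continuous f} -> compact (graph x f).
Proof.
move=> fc; apply: continuous_compact; last exact: segment_compact.
apply/subspace_continuousP => t Dt.
apply: (@cvg_pair _ _ _ _ (nbhs t) (nbhs (f t))); first exact: cvg_within.
by move/subspace_continuousP : fc; exact.
Qed.

Lemma graph_in_strip f : {within dom x, continuous f} ->
  nonempty_compact_in (dom x) (graph x f).
Proof.
move=> fc; split; [exact: graph_neq0|exact: graph_compact|].
by move=> _ [t Dt <-].
Qed.

Lemma W_iter_neq0 m : W_iter x c p z sigma m !=set0.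
Proof.
elim: m => [|m [u Au]] /=; first by exists (x ord0, z ord0), ord0.
pose n := Ordinal N0.
by exists (L x n u.1, F c p n (sigma m) u.1 u.2), n => //; exists u.
Qed.

Lemma W_iter_finite m : finite_set (W_iter x c p z sigma m).
Proof.
elim: m => [|m IH] /=; first by apply: finite_image; apply: finite_finset.
apply: bigcup_finite => [|n _]; [exact: finite_finset|exact: finite_image].
Qed.

Lemma W_iter_dom m u : W_iter x c p z sigma m u -> dom x u.1.
Proof.
elim: m u => [|m IH] u /=; first by case=> i _ <-; exact: node_in_dom.
by case=> n _ [v /IH Dv <-] /=; exact: L_dom.
Qed.

Lemma W_iter_in_strip m :
  nonempty_compact_in (dom x) (W_iter x c p z sigma m).
Proof.
split; [exact: W_iter_neq0|exact/finite_compact/W_iter_finite|].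
by move=> u /W_iter_dom.
Qed.

(** A letter k used infinitely often maps iterates close to the graph of f to
    iterates close to the graph of f. Hence the image under the n-th map of a
    point of the graph is a limit of points of the graph, and continuity of f
    puts it on the graph: convergence makes the graph invariant under [W k]. *)
Lemma self_referential_of_attractor f k :
  {within dom x, continuous f} ->
  (forall n k, {within dom x, continuous (p n k)}) ->
  (forall n k, `|c n k| < 1) ->
  is_attractor x c p z sigma (graph x f) ->
  (forall m0, exists2 m, (m0 <= m)%N & sigma m = k) ->
  self_referential x c p k f.
Proof.
move=> fc pc c1 [_ _ cv] freq n t Dt.
apply/eqP; rewrite -subr_eq0 -normr_le0; apply/ler_addgt0Pl => e' e'0.
rewrite addr0; have [e e0 ->] : exists2 e, 0 < e & e' = 4 * e.
  by exists (e' / 4); [lra|field].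
have [d1 d10 H1] := (within_continuousP _ _).1 fc _ (L_dom hx N0 n Dt) e e0.
have [d2 d20 H2] := (within_continuousP _ _).1 (pc n k) _ Dt e e0.
have [d [d0 dd1 dd2 de]] : exists d, [/\ 0 < d, 2 * d <= d1, d <= d2 & d <= e].
  exists (Num.min (d1 / 2) (Num.min d2 e)); split.
  - by rewrite !lt_min d20 e0 divr_gt0.
  - by rewrite mulrC -ler_pdivlMr // ge_min lexx.
  - by rewrite !ge_min lexx !orbT.
  - by rewrite !ge_min lexx !orbT.
have [m0 _ Hm0] : \forall m \near \oo,
    hausdorff_dist (W_iter x c p z sigma m) (graph x f) < d.
  have /cvgr_dist_lt/(_ d d0) := cv; apply: filterS => m.
  by rewrite sub0r normrN; apply: le_lt_trans; exact: ler_norm.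
have [m m0m smk] := freq m0.
have [A0 cA _] := graph_in_strip fc.
(* u is an iterate close to the point of the graph above t, r the abscissa of
   a point of the graph close to the image of u. *)
have [u Au fu] : exists2 u, W_iter x c p z sigma m u & edist2 (t, f t) u < d.
  apply: (@hausdorff_dist_lt _ (graph x f)) => //; first exact: W_iter_neq0.
    by rewrite hausdorff_distC; exact: Hm0.
  by exists t.
have [_ [r Dr <-] ur] : exists2 v, graph x f v &
    edist2 (L x n u.1, F c p n (sigma m) u.1 u.2) v < d.
  apply: (@hausdorff_dist_lt _ (W_iter x c p z sigma m.+1)) => //.
  - exact/finite_compact/W_iter_finite.
  - by apply: Hm0; exact: leqW.
  - by exists n => //; exists u.
have Du := W_iter_dom Au.
have tu := le_lt_trans (dist1_le_edist2 _ _) fu.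
have fu2 := le_lt_trans (dist2_le_edist2 _ _) fu.
have ur1 := le_lt_trans (dist1_le_edist2 _ _) ur.
have ur2 := le_lt_trans (dist2_le_edist2 _ _) ur.
rewrite /= smk in tu fu2 ur1 ur2.
have h1 : `|f (L x n t) - f r| < e.
  apply: H1 => //; apply: lt_le_trans dd1.
  rewrite -(subrK (L x n u.1) (L x n t)) -addrA (le_lt_trans (ler_normD _ _)) //.
  rewrite L_sub normrM (gtr0_norm (La_gt0 hx N0 n)).
  have := La_le1 hx N0 n; have := La_gt0 hx N0 n; have := normr_ge0 (t - u.1).
  move: (La x n) (`|_ - _|) tu (`|_ - r|) ur1 => a s ? s' ? ? ? ?.
  have : a * s <= 1 * s by apply: ler_wpM2r.
  lra.
have h2 : `|p n k t - p n k u.1| < e by apply: H2 => //; exact: lt_le_trans dd2.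
have h3 : `|c n k * (f t - u.2)| <= d.
  rewrite normrM -[leRHS]mul1r; apply: ler_pM => //; apply/ltW => //.
have -> : f (L x n t) - F c p n k t (f t) =
  (f (L x n t) - f r) - (F c p n k u.1 u.2 - f r)
  - c n k * (f t - u.2) - (p n k t - p n k u.1) by rewrite /F; ring.
apply: le_trans (ler_normB _ _) _.
have := ler_normB (f (L x n t) - f r - (F c p n k u.1 u.2 - f r))
  (c n k * (f t - u.2)).
have := ler_normB (f (L x n t) - f r) (F c p n k u.1 u.2 - f r).
lra.
Qed.

(** Once the letters fix f, each step multiplies the vertical distance of the
    iterates to the graph of f by at most the largest |c n k|, and the abscissas
    of the iterates fill [dom x] up to gaps that shrink like the powers of the
    largest slope of the maps [L x n]. The Lipschitz bound turns horizontal gaps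
    into vertical ones. *)
Lemma attractor_of_self_referential f K m0 :
  (forall n k, `|c n k| < 1) ->
  (forall s t, dom x s -> dom x t -> `|f s - f t| <= K * `|s - t|) ->
  {within dom x, continuous f} ->
  (forall m, (m0 <= m)%N -> self_referential x c p (sigma m) f) ->
  is_attractor x c p z sigma (graph x f).
Proof.
move=> c1 fL fc fS.
split; [exact: W_iter_in_strip|exact: graph_in_strip|].
have [a /andP[a0 a1] aP] := finite_lt1_bound (fun n => La_lt1 hx N0 n N1).
have [b /andP[b0 b1] bP] := finite_lt1_bound
  (f := fun nk : 'I_N * 'I_M => `|c nk.1 nk.2|)
  (fun nk => c1 nk.1 nk.2).
set A := W_iter x c p z sigma.
have [C C0 AC] : exists2 C, 0 <= C & forall u, A m0 u -> `|u.2 - f u.1| <= C.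
  have : compact [set u.2 - f u.1 | u in A m0].
    exact/finite_compact/finite_image/W_iter_finite.
  move=> /compact_bounded[C [_ /(_ (`|C| + 1))]].
  rewrite (le_lt_trans (ler_norm C)) ?ltrDl// => /(_ isT) HC.
  exists (`|C| + 1); first by rewrite addr_ge0.
  by move=> u Au; apply: HC; exists u.
set D := x ord_max - x ord0.
have D0 : 0 <= D by rewrite subr_ge0 ltW // ends_lt.
have K0 : 0 <= K.
  have := fL (x ord_max) (x ord0) (node_in_dom hx _) (node_in_dom hx _).
  move=> /(le_trans (normr_ge0 _)).
  by rewrite pmulr_lge0 // normr_gt0 subr_eq0 gt_eqF // ends_lt.
have vert j u : A (m0 + j)%N u -> `|u.2 - f u.1| <= C * b ^+ j.
  elim: j u => [|j IH] u; first by rewrite addn0 expr0 mulr1; exact: AC.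
  rewrite addnS => -[n _ [v Av <-]] /=.
  rewrite (fS (m0 + j)%N (leq_addr _ _)); last exact: W_iter_dom Av.
  rewrite /F opprD addrACA subrr addr0 -mulrBr normrM exprS mulrCA.
  by apply: ler_pM => //; [exact: (bP (n, _))|exact: IH].
have horiz j t : dom x t -> exists2 u, A (m0 + j)%N u & `|t - u.1| <= D * a ^+ j.
  elim: j t => [|j IH] t Dt.
    have [u Au] := W_iter_neq0 m0; exists u; rewrite ?addn0 // expr0 mulr1.
    have := W_iter_dom Au; move: Dt; rewrite /dom /= !in_itv /=.
    move=> /andP[? ?] /andP[? ?].
    by rewrite ler_norml /D; lra.
  have [n [s [Ds <-]]] := L_surj hx N0 Dt.
  have [u Au su] := IH s Ds.
  exists (L x n u.1, F c p n (sigma (m0 + j)%N) u.1 u.2).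
    by rewrite addnS; exists n => //; exists u.
  rewrite /= L_sub normrM (gtr0_norm (La_gt0 hx N0 n)) exprS mulrCA.
  by apply: ler_pM => //; exact/ltW/La_gt0.
rewrite -(cvg_shiftn m0) /=.
apply: (@squeeze_cvgr _ _ _ _ (fun=> 0)
  (fun j => (1 + K) * D * a ^+ j + C * b ^+ j)).
- near=> j; rewrite hausdorff_dist_ge0 /= addnC; apply: hausdorff_dist_le.
  + exact: W_iter_neq0.
  + exact: graph_neq0.
  + move=> u Au; exists (u.1, f u.1).
      by exists u.1 => //; exact: W_iter_dom Au.
    apply: le_trans (edist2_le_sum _ _) _; rewrite /= subrr normr0 add0r.
    apply: le_trans (vert _ _ Au) _; rewrite lerDr.
    apply: mulr_ge0; [apply: mulr_ge0 => //; exact: addr_ge0|].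
    exact: exprn_ge0.
  + move=> _ [t Dt <-]; have [u Au tu] := horiz j t Dt; exists u => //.
    apply: le_trans (edist2_le_sum _ _) _ => /=.
    have h1 := vert _ _ Au.
    have h2 := fL _ _ Dt (W_iter_dom Au).
    have h3 : K * `|t - u.1| <= K * (D * a ^+ j) by apply: ler_wpM2l.
    have := ler_distD (f u.1) (f t) u.2; rewrite (distrC (f u.1)); lra.
- exact: cvg_cst.
- rewrite -(addr0 0); apply: cvgD; apply: cvg_geometric; rewrite ger0_norm //.
Unshelve. all: by end_near.
Qed.
End Attractor.

(** * Indefinite integrals of continuous functions *)

Lemma lipschitz_within_continuous {R : realType} (D : set R) (f : R -> R) K :
  (forall s t, D s -> D t -> `|f s - f t| <= K * `|s - t|) ->
  {within D, continuous f}.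
Proof.
move=> fL; apply/within_continuousP => t Dt e e0.
exists (e / (`|K| + 1)); first by rewrite divr_gt0 // ltr_wpDl.
move=> s Ds; rewrite ltr_pdivlMr ?ltr_wpDl // => ts.
apply: le_lt_trans (fL _ _ Dt Ds) (le_lt_trans _ ts).
rewrite mulrC; apply: ler_wpM2l => //.
by rewrite (le_trans (ler_norm K)) // lerDl.
Qed.

Section Integral.
Context {R : realType}.
Local Notation mu := (@lebesgue_measure R).
Implicit Types (a b s t : R) (f : R -> R).

Lemma within_continuous_integrable f a b : {within `[a, b], continuous f} ->
  mu.-integrable `[a, b] (EFin \o f).
Proof.
move=> fc; apply: continuous_compact_integrable => //.
exact: segment_compact.
Qed.

Lemma Rintegral_chasles f a s t : a <= s -> s <= t ->
  {within `[a, t], continuous f} ->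
  \int[mu]_(u in `[a, t]) f u =
  \int[mu]_(u in `[a, s]) f u + \int[mu]_(u in `[s, t]) f u.
Proof.
move=> as_ st fc; apply/eqP; rewrite addrC -subr_eq; apply/eqP.
have fi := within_continuous_integrable fc.
rewrite (Rintegral_itvB fi) ?bnd_simp //.
have sub : `]s, t] `<=` `[a, t].
  move=> u /=; rewrite !in_itv /= => /andP[su ->].
  by rewrite (le_trans as_ (ltW su)).
have fi' : mu.-integrable `]s, t] (EFin \o f) by apply: integrableS fi.
by rewrite Rintegral_itv_obnd_cbnd.
Qed.

Lemma Rintegral_lipschitz f a b : {within `[a, b], continuous f} ->
  exists K, forall s t, s \in `[a, b] -> t \in `[a, b] ->
    `|\int[mu]_(u in `[a, s]) f u - \int[mu]_(u in `[a, t]) f u|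
      <= K * `|s - t|.
Proof.
move=> fc.
have [C [_ /(_ (C + 1))]] :=
  compact_bounded (continuous_compact fc (@segment_compact _ a b)).
rewrite ltrDl ltr01 => /(_ isT) HC.
exists (C + 1) => s t; wlog st : s t / s <= t => [H sab tab|].
  have [|/ltW] := leP s t => st; first exact: H.
  by rewrite distrC (distrC s); exact: H.
rewrite !in_itv /= => /andP[as_ sb] /andP[at_ tb].
have sub : `[a, t] `<=` `[a, b].
  by move=> u /=; rewrite !in_itv /= => /andP[-> ut]; exact: le_trans tb.
have sub' : `[s, t] `<=` `[a, b].
  move=> u /=; rewrite !in_itv /= => /andP[su ut].
  by rewrite (le_trans as_ su) (le_trans ut tb).
have fcs := continuous_subspaceW sub fc; have fcs' := continuous_subspaceW sub' fc.
have fi := within_continuous_integrable fcs'.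
rewrite (Rintegral_chasles as_ st) // opprD addrA subrr sub0r normrN.
apply: le_trans (le_normr_Rintegral _ fi) _ => //.
rewrite distrC (ger0_norm (_ : 0 <= t - s)) ?subr_ge0 //.
have -> : (C + 1) * (t - s) = \int[mu]_(u in `[s, t]) (cst (C + 1)) u.
  have e := lebesgue_measure_itv `[s, t].
  rewrite Rintegral_cst //= [mu _]e /= lte_fin.
  by case: ltP => // ts; rewrite (_ : s = t) ?subrr ?mulr0 //; apply/le_anti/andP.
apply: le_Rintegral => //.
- exact: integrable_norm.
- apply: within_continuous_integrable; apply: continuous_subspaceT => u.
  exact: cvg_cst.
- by move=> u u1; apply: HC; exists u => //; exact: sub'.
Qed.

Lemma Rintegral_affine f (c d : R) s t : 0 < c -> s <= t ->
  {within `[c * s + d, c * t + d], continuous f} ->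
  \int[mu]_(u in `[c * s + d, c * t + d]) f u =
  c * \int[mu]_(u in `[s, t]) f (c * u + d).
Proof.
move=> c0 st fc.
pose h (u : R) := c * u + d.
have hd u : is_derive u (1 : R) h c.
  rewrite (_ : c = c *: 1 + 0); last by rewrite addr0 /GRing.scale /= mulr1.
  exact: is_deriveD.
have dh : h^`()%classic = cst c.
  by apply/funext => u; rewrite derive1E; apply: derive_val.
have hc : continuous h.
  move=> u; apply: differentiable_continuous; apply/derivable1_diffP.
  exact: ex_derive.
have fhc : {within `[s, t], continuous (f \o h)}.
  apply/within_continuousP => u su e e0.
  have hu v : `[s, t]%classic v -> `[c * s + d, c * t + d]%classic (h v).
    by rewrite /= !in_itv /= !lerD2r !ler_pM2l.
  have [del del0 H] := (within_continuousP _ _).1 fc _ (hu _ su) e e0.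
  exists (del / c); first exact: divr_gt0.
  move=> v sv; rewrite ltr_pdivlMr // => uv; apply: H; first exact: hu.
  by rewrite /h opprD addrACA subrr addr0 -mulrBr normrM gtr0_norm // mulrC.
rewrite -RintegralZl //; last exact: within_continuous_integrable.
rewrite /Rintegral; congr fine.
rewrite (@integration_by_substitution_increasing _ h f s t) //.
- by apply: eq_integral => u _; rewrite dh /= mulrC.
- by move=> u v _ _ uv; rewrite /h ltrD2r ltr_pM2l.
- by rewrite dh => u _; exact: cvg_cst.
- by rewrite dh; apply: is_cvg_cst.
- by rewrite dh; apply: is_cvg_cst.
- split.
  + by move=> u _; exact: ex_derive.
  + exact/cvg_at_right_filter/hc.
  + exact/cvg_at_left_filter/hc.
Qed.
End Integral.

(** * The integrated system *)

Section IntegratedSystem.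
Context {R : realType} {N M : nat} {x : 'I_N.+1 -> R}.
Context {gamma : 'I_N -> 'I_M -> R} {q : 'I_N -> 'I_M -> R -> R}.
Hypothesis hx : forall i j : 'I_N.+1, (i < j)%N -> x i < x j.
Hypothesis N1 : (1 < N)%N.
Let N0 : (0 < N)%N := ltnW N1.
Hypothesis gamma1 : forall n k, `|gamma n k| < 1.
Hypothesis qc : forall n k, {within dom x, continuous (q n k)}.

Lemma integral_to_ord0 (f : R -> R) : integral_to x f (x ord0) = 0.
Proof. by rewrite /integral_to set_itv1 Rintegral_set1. Qed.

Lemma integral_to_lipschitz f : {within dom x, continuous f} ->
  exists K, forall s t, dom x s -> dom x t ->
    `|integral_to x f s - integral_to x f t| <= K * `|s - t|.
Proof. exact: Rintegral_lipschitz. Qed.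

(** Integrating the self-referential equation of f over the n-th subinterval and
    substituting [L x n u] for the variable brings out the factor [La x n], which
    is why the vertical scalings of the integrated system are [La x n * gamma]. *)
Lemma integral_to_L f k n t : {within dom x, continuous f} ->
  self_referential x gamma q k f -> dom x t ->
  integral_to x f (L x n t) = integral_to x f (x (lnode n)) +
    La x n * (gamma n k * integral_to x f t + integral_to x (q n k) t).
Proof.
move=> fc fS Dt.
have := Dt; rewrite /dom /= in_itv /= => /andP[t0 t1].
have := L_dom hx N0 n Dt; rewrite /dom /= in_itv /= => /andP[Lt0 Lt1].
have sub s : s <= x ord_max -> `[x ord0, s] `<=` dom x.
  move=> s1 u /=; rewrite /dom /= !in_itv /= => /andP[-> us].
  exact: le_trans s1.
have nt : x (lnode n) <= L x n t by rewrite -(L_lnode hx N0) L_le.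
have n0 : x ord0 <= x (lnode n) by exact: node_le.
rewrite /integral_to (Rintegral_chasles n0 nt); last first.
  exact: continuous_subspaceW (sub _ Lt1) fc.
congr (_ + _); rewrite -(L_lnode hx N0) /L Rintegral_affine ?La_gt0 //; last first.
  have := L_lnode hx N0 n; rewrite /L => ->.
  apply: continuous_subspaceW fc => u /=.
  rewrite /dom /= !in_itv /= => /andP[nu uL].
  by rewrite (le_trans n0 nu) (le_trans uL Lt1).
congr (_ * _).
have ci g : {within dom x, continuous g} ->
    (@lebesgue_measure R).-integrable `[x ord0, t] (EFin \o g).
  move=> gc; apply: within_continuous_integrable.
  exact: continuous_subspaceW (sub _ t1) gc.
transitivity (\int[@lebesgue_measure R]_(u in `[x ord0, t])
    (gamma n k * f u + q n k u)).
  by apply: eq_Rintegral => u; rewrite inE => Du; exact/fS/(sub _ t1).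
have cgf : {within dom x, continuous (fun u => gamma n k * f u)}.
  by apply: within_continuous_comp fc => y _; exact: mulrl_continuous.
by rewrite RintegralD ?RintegralZl //; exact: ci.
Qed.

Lemma integral_to_nodes f k : {within dom x, continuous f} ->
  self_referential x gamma q k f ->
  forall i, integral_to x f (x i) = \sum_(j < N | (j < i)%N) La x j *
    (gamma j k * integral_to x f (x ord_max) + integral_to x (q j k) (x ord_max)).
Proof.
move=> fc fS i.
rewrite (telescope_nodes (u := fun i => integral_to x f (x i))
  (f := fun j => La x j * (gamma j k * integral_to x f (x ord_max) +
                           integral_to x (q j k) (x ord_max)))).
  by rewrite integral_to_ord0 add0r.
by move=> n; rewrite -(L_rnode hx N0) (integral_to_L n fc fS (node_in_dom hx _)).
Qed.

(** The slopes [La x j] are weights of sum 1 and each |gamma j k| is below 1, so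
    the denominator of [rise] is positive. *)
Lemma one_minus_sum_gt0 k : 0 < 1 - \sum_(j < N) La x j * gamma j k.
Proof.
rewrite -(sum_La hx N0) -sumrB (bigD1 (Ordinal N0)) //=.
have H j : 0 < La x j - La x j * gamma j k.
  rewrite -{1}(mulr1 (La x j)) -mulrBr mulr_gt0 ?La_gt0 // subr_gt0.
  exact: le_lt_trans (ler_norm _) (gamma1 _ _).
by rewrite ltr_wpDr ?H // sumr_ge0 // => j _; exact/ltW.
Qed.

(** At the last node the expression for the integral up to the nodes is a linear
    equation for the total integral; [rise] is its solution. *)
Lemma integral_to_rise f k : {within dom x, continuous f} ->
  self_referential x gamma q k f ->
  integral_to x f (x ord_max) = rise x gamma q k.
Proof.
move=> fc fS; have d0 := one_minus_sum_gt0 k.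
have := integral_to_nodes fc fS ord_max.
rewrite (eq_bigl predT) => [|j]; last by rewrite ltn_ord.
under eq_bigr do rewrite mulrDr mulrA.
rewrite big_split /= -mulr_suml => e.
apply: (mulIf (lt0r_neq0 d0)); rewrite divfK ?lt0r_neq0 //.
by rewrite mulrBr mulr1 {1}e; ring.
Qed.

Variable hy0 : R.

Lemma integral_to_hat_y f k i : {within dom x, continuous f} ->
  self_referential x gamma q k f ->
  hy0 + integral_to x f (x i) = hat_y x gamma q hy0 i k.
Proof.
move=> fc fS; rewrite (integral_to_nodes fc fS) (integral_to_rise fc fS).
rewrite /hat_y; congr (_ + _); apply: eq_bigr => j _.
by rewrite /hat_yN addrAC subrr add0r.
Qed.

(** The term [hat_y] in [hat_q] is the value of [hy0] plus the integral at the
    left end of the subinterval, by [integral_to_hat_y]; the rest is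
    [integral_to_L], where the term [La x n * gamma n k * hy0] makes up for the
    integration constant inside [F]. *)
Lemma self_referential_integral f k : {within dom x, continuous f} ->
  self_referential x gamma q k f ->
  self_referential x (hat_gamma x gamma) (hat_q x gamma q hy0) k
    (fun s => hy0 + integral_to x f s).
Proof.
move=> fc fS n t Dt; rewrite (integral_to_L n fc fS Dt) addrA.
rewrite (integral_to_hat_y _ fc fS) /F /hat_gamma /hat_q; ring.
Qed.

Lemma hat_gamma_lt1 n k : `|hat_gamma x gamma n k| < 1.
Proof.
rewrite normrM (gtr0_norm (La_gt0 hx N0 n)).
by rewrite (le_lt_trans _ (gamma1 n k)) // ler_piMl ?La_le1.
Qed.

(** The join-up condition at the right ends is one step of the partial sums that
    define [hat_y], as [hat_yN] is the last of them. *)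
Lemma hat_is_SIFS hy : (forall n k l, k != l -> gamma n k != gamma n l) ->
  (forall i k, hat_y x gamma q hy0 i k = hy i) ->
  is_SIFS x (hat_gamma x gamma) (hat_q x gamma q hy0) hy.
Proof.
move=> gneq hhy; split.
- exact: hat_gamma_lt1.
- move=> n k l /(gneq n); apply: contra_neq => /mulfI; apply.
  exact/lt0r_neq0/La_gt0.
- move=> n k; have [K HK] := integral_to_lipschitz (@qc n k).
  apply: (@lipschitz_within_continuous _ _ _ (La x n * K)) => s t Ds Dt.
  rewrite /hat_q opprD addrACA subrr add0r -mulrBr normrM.
  rewrite (gtr0_norm (La_gt0 hx N0 n)) -[leRHS]mulrA.
  by apply: ler_wpM2l; [exact/ltW/La_gt0|exact: HK].
- move=> n k; rewrite /F /hat_gamma /hat_q -!(hhy _ k).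
  rewrite hat_y_max ?lt0r_neq0 ?one_minus_sum_gt0 // integral_to_ord0 hat_y_0.
  split; first by ring.
  rewrite [RHS]/hat_y sum_lt_rnode [RHS]addrA.
  by rewrite -/(hat_y x gamma q hy0 (lnode n) k); ring.
Qed.
End IntegratedSystem.

Theorem theorem4p1 (R : realType) (N M : nat) (x y : 'I_N.+1 -> R)
    (gamma : 'I_N -> 'I_M -> R) (q : 'I_N -> 'I_M -> R -> R)
    (hy0 : R) (hy : 'I_N.+1 -> R) (sigma : nat -> 'I_M) (g : R -> R)
    (hN : (2 <= N)%N) (hM : (1 < M)%N)
    (hx : forall i j : 'I_N.+1, (i < j)%N -> x i < x j)
    (hq : forall n k, exists u v : R, forall t, q n k t = u * t + v)
    (hSIFS : is_SIFS x gamma q y)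
    (hrise : forall k l : 'I_M, k != l ->
       rise x gamma q k = rise x gamma q l /\ rise x gamma q l != 1)
    (hhy : forall i k, hat_y x gamma q hy0 i k = hy i)
    (hg : is_SFIF x gamma q y sigma g) :
  is_SIFS x (hat_gamma x gamma) (hat_q x gamma q hy0) hy /\
  is_SFIF x (hat_gamma x gamma) (hat_q x gamma q hy0) hy sigma
    (fun s => hy0 + \int[lebesgue_measure]_(t in `[x ord0, s]) g t).
Proof.
have [gamma1 gneq qc _] := hSIFS; have [gc gA] := hg.
split; first exact: hat_is_SIFS.
(* Letters that recur for ever fix g, so all letters do from some rank on. *)
have [m0 gS] := eventually_of_frequent (fun k =>
  self_referential_of_attractor hx hN gc qc gamma1 gA (k := k)).
have [K HK] := integral_to_lipschitz gc.
have hL s t : dom x s -> dom x t ->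
    `|hy0 + integral_to x g s - (hy0 + integral_to x g t)| <= K * `|s - t|.
  by move=> Ds Dt; rewrite opprD addrACA subrr add0r; exact: HK.
have hc := lipschitz_within_continuous hL.
split=> //; apply: (attractor_of_self_referential (m0 := m0) hx hN _ hL hc).
- exact: hat_gamma_lt1.
- by move=> m m0m; apply: self_referential_integral => //; exact: gS.
Qed.
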